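(* If a ladder system $\mathcal L=(L_\alpha:\alpha\in\mathrm{Lim})$ on $\omega_1$ is a $\clubsuit^*$ sequence, then $\Psi(\mathcal L)$ is not semi-proximal.
   Context: $\mathrm{Lim}$ is the set of all (nonzero) countable limit ordinals. A ladder system is a family $\mathcal L=(L_\alpha:\alpha\in\mathrm{Lim})$ where each $L_\alpha$ is a cofinal subset of $\alpha$ of order type $\omega$. It is a $\clubsuit^*$ sequence if for each uncountable $A\subseteq\omega_1$ the set $\{\alpha\in\mathrm{Lim}: |L_\alpha\cap A|=\aleph_0\}$ contains a club of $\omega_1$. $\Psi(\mathcal L)$ is the space with underlying set $(\omega_1\times\{0\})\cup(\mathrm{Lim}\times\{1\})$, in which $\omega_1\times\{0\}$ is open and discrete, and for $\alpha\in\mathrm{Lim}$ a local basis at $(\alpha,1)$ is $\{\{(\alpha,1)\}\cup((L_\alpha\setminus\xi)\times\{0\}) : \xi<\alpha\}$. Proximal game on a uniform space $(Z,\mathbb U)$: for an entourage $U$ write $U[x]=\{y\in Z : (x,y)\in U\}$. At inning $0$ Player I plays $U_0\in\mathbb U$ and Player II plays $x_0\in Z$; at inning $n+1$ Player I plays $U_{n+1}\in\mathbb U$ with $U_{n+1}\subseteq U_n$ and Player II plays $x_{n+1}\in U_n[x_n]$. Player I wins if $(x_n)_{n\in\omega}$ converges in the topology induced by $\mathbb U$ or $\bigcap_{n\in\omega}U_n[x_n]=\emptyset$; otherwise Player II wins. $(Z,\mathbb U)$ is semi-proximal if Player II has no winning strategy. A strategy for Player II assigns a legal move to each finite sequence of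 moves of Player I; it is winning if Player II wins every run following it. A topological space is semi-proximal if there is a uniformity $\mathbb U$ inducing its topology for which the uniform space is semi-proximal. *)

(* Defs.v *)
From HB Require Import structures.
From mathcomp Require Import all_boot all_order.
From mathcomp Require Import boolp classical_sets functions cardinality filter.
From mathcomp Require Import topology wochoice.
Set Implicit Arguments.
Unset Strict Implicit.
Unset Printing Implicit Defensive.
Import Order.TTheory.
Local Open Scope classical_set_scope.
Local Open Scope order_scope.

(** The ordinal omega_1 is represented by an arbitrary order of type omega_1:
    by well-foundedness and the two cardinality conditions, [W] is uniquely
    determined up to order isomorphism. *)
Definition is_omega1 d (W : orderType d) : Prop :=
  [/\ well_founded (fun x y : W => x < y),
      ~ countable [set: W] &
      forall a : W, countable [set b : W | b < a]].

Lemma omega1_exists : exists d (W : orderType d), is_omega1 W.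
Proof.
pose T : choiceType := set nat.
have [R woR] := well_ordering_principle T.
have woT : wo_chain R predT by move=> A _; exact: woR.
have Rtot : total R by move=> x y; exact: wo_chainW woT x y isT isT.
have Rr : reflexive R by move=> x; exact: wo_chain_reflexive woT x isT.
have Ra : antisymmetric R.
  by move=> x y; exact: wo_chain_antisymmetric woT x y isT isT.
have Rmin (A : set T) : A !=set0 -> exists2 z, A z & forall y, A y -> R z y.
  move=> [x Ax]; have [|z [[zA zm] _]] := woR (mem A).
    by exists x; rewrite inE.
  by exists z; [rewrite inE in zA|move=> y Ay; apply: zm; rewrite inE].
have Rt : transitive R.
  move=> y x z Rxy Ryz.
  have [|m + mm] := Rmin [set x; y; z]; first by exists x; left; left.
  have xm := mm x (or_introl (or_introl erefl)).
  have ym := mm y (or_introl (or_intror erefl)).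
  have zm := mm z (or_intror erefl).
  case=> [[|]|] E; rewrite -> E in * => //.
    by rewrite (Ra x y) // Rxy.
  by rewrite -(Ra y z) // Ryz.
pose C a := `[< countable [set b | R b a] >].
pose S := {a : T | C a}.
pose leS (x y : S) := R (val x) (val y).
have leSr : reflexive leS by move=> x; exact: Rr.
have leSa : antisymmetric leS by move=> x y /Ra/val_inj.
have leSt : transitive leS by move=> x y z; exact: Rt.
pose PS := Order.Le_isPOrder.Build (Order.Disp tt tt) S leSr leSa leSt.
pose P : porderType _ := HB.pack S PS.
have leST : total (<=%O : rel P) by move=> x y; exact: Rtot.
pose W : orderType _ := HB.pack S P (Order.POrder_isTotal.Build _ P leST).
exists _, W; split.
- move=> a; apply: contrapT => nAa.
  have [|_ [z nz <-] zm] := Rmin (val @` [set z : S | ~ Acc (fun x y : W => x < y) z]).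
    by exists (val (a : S)), a.
  apply: nz; constructor=> y yz; apply: contrapT => nAy.
  have zy : R (val (z : S)) (val (y : S)) by apply: zm; exists y.
  by move: yz; rewrite ltNge => /negP; apply.
- move=> cW.
  have cC : countable [set a : T | C a].
    have -> : [set a : T | C a] = val @` [set: S].
      by apply/seteqP; split=> [a Ca|_ [x _ <-]]; [exists (exist _ a Ca)|exact: valP].
    exact: sub_countable (card_image_le _ _) cW.
  have [allC|] := pselect (forall a, C a).
    have /countable_injP[f fI'] := cC.
    have fI : injective f by move=> x y; apply: fI'; rewrite inE; exact: allC.
    pose D := [set n | exists2 A : set nat, f A = n & ~ A n].
    have [DD|nDD] := pselect (D (f D)).
      by have [A /fI AD nA] := DD; apply: nA; rewrite AD.
    by apply: (nDD); exists D.
  move=> /existsNP nC; have [m nm mm] := Rmin [set a | ~ C a] nC.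
  apply: nm; apply/asboolP.
  have cU : countable (\bigcup_(b in [set: bool]) if b then [set a | C a] else [set m]).
    by apply: bigcup_countable => // -[].
  apply: sub_countable cU; apply: subset_card_le => b /= Rbm.
  have [Cb|nCb] := pselect (C b); first by exists true.
  by exists false => //=; apply: Ra; rewrite Rbm mm.
- move=> a; have /asboolP := valP (a : S).
  move=> /countable_injP[f fI]; apply/countable_injP.
  exists (fun x : W => f (val (x : S))) => x y.
  rewrite !inE => xa ya /fI exy; apply/val_inj/exy; rewrite inE.
    exact: (@ltW _ W x a xa).
  exact: (@ltW _ W y a ya).
Qed.

(** The first conjunct excludes the ordinal 0. *)
Definition Lim d (W : orderType d) : set W :=
  [set a | (exists b, b < a) /\ (forall b, b < a -> exists2 c, b < c & c < a)].
Arguments Lim {d} W.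

Section Ladder.
Context d (W : orderType d).

(** [L : Lim W -> set W] is a family indexed by the subtype [Lim W] of [W];
    [val] is the inclusion. *)

Definition cofinal_in (A : set W) (a : W) : Prop :=
  (forall b, A b -> b < a) /\ (forall b, b < a -> exists2 c, A c & b <= c).

Definition order_type_omega (A : set W) : Prop :=
  exists2 e : nat -> W, {homo e : m n / (m < n)%N >-> m < n} & A = range e.

Definition ladder_system (L : Lim W -> set W) : Prop :=
  forall a : Lim W, cofinal_in (L a) (val a) /\ order_type_omega (L a).

Definition club (C : set W) : Prop :=
  (forall a, exists2 c, C c & a < c) /\
  (forall a, Lim W a ->
     (forall b, b < a -> exists c, [/\ C c, b < c & c < a]) -> C a).

Definition club_star (L : Lim W -> set W) : Prop :=
  forall A : set W, ~ countable A ->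
    exists2 C : set W, club C &
      C `<=` [set val a | a in [set a : Lim W | (L a `&` A #= [set: nat])%card]].

(** Underlying set of the space: [inl a] is (a,0) and [inr a] is (a,1). *)
Definition Psi (L : Lim W -> set W) : Type := (W + Lim W)%type.

Variable L : Lim W -> set W.

HB.instance Definition _ := gen_eqMixin (Psi L).
HB.instance Definition _ := gen_choiceMixin (Psi L).

(** For an ordinal xi, [L a] minus xi is [L a] minus the set of all b < xi. *)
Definition Psi_base (a : Lim W) (xi : W) : set (Psi L) :=
  inr a |` (inl @` (L a `\` [set b | b < xi])).

Definition Psi_nbhs (p : Psi L) : set_system (Psi L) :=
  match p with
  | inl x => principal_filter (inl x : Psi L)
  | inr a => filter_from [set xi | xi < val a] (Psi_base a)
  end.

HB.instance Definition _ := hasNbhs.Build (Psi L) Psi_nbhs.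

Let Psi_nbhs_filter (p : Psi L) : ProperFilter (nbhs p).
Proof.
case: p => [x|a]; first exact: principal_filter_proper.
apply: filter_from_proper; last by move=> xi _; exists (inr a); left.
apply: filter_from_filter.
  by have [[b ba] _] := set_valP a; exists b.
move=> i j ia ja; exists (Order.max i j); first by rewrite /= gt_max ia ja.
move=> t [->|[b [Lb /negP]]]; first by split; left.
rewrite -leNgt ge_max => /andP[ib jb] <-.
by split; right; exists b => //; split=> //=; apply/negP; rewrite -leNgt.
Qed.

Let Psi_nbhs_singleton (p : Psi L) (A : set (Psi L)) : nbhs p A -> A p.
Proof.
by case: p => [x /principal_filterP//|a [xi _ sA]]; apply: sA; left.
Qed.

Let Psi_nbhs_nbhs (p : Psi L) (A : set (Psi L)) :
  nbhs p A -> nbhs p (nbhs^~ A).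
Proof.
case: p => [x /principal_filterP Ax|a [xi xia sA]].
  by apply/principal_filterP; apply/principal_filterP.
exists xi => // t [->|[b Lb <-]]; first by exists xi.
by apply/principal_filterP; apply: sA; right; exists b.
Qed.

HB.instance Definition _ := Nbhs_isNbhsTopological.Build (Psi L)
  Psi_nbhs_filter Psi_nbhs_singleton Psi_nbhs_nbhs.

End Ladder.

Section ProximalGame.
Context {Z : uniformType}.

(** Finite sequences of legal moves of Player I. *)
Definition legal_moves1 (s : seq (set (Z * Z))) : Prop :=
  (forall i, (i < size s)%N -> entourage (nth setT s i)) /\
  (forall i, (i.+1 < size s)%N -> nth setT s i.+1 `<=` nth setT s i).

Definition run1 (U : nat -> set (Z * Z)) : Prop :=
  (forall n, entourage (U n)) /\ (forall n, U n.+1 `<=` U n).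

(** [sigma [:: U_0; ...; U_n]] is the answer x_n of Player II; the values of
    [sigma] outside nonempty legal sequences are irrelevant. *)
Definition strategy2 (sigma : seq (set (Z * Z)) -> Z) : Prop :=
  forall s U V, legal_moves1 (rcons (rcons s U) V) ->
    xsection U (sigma (rcons s U)) (sigma (rcons (rcons s U) V)).

Definition wins1 (U : nat -> set (Z * Z)) (x : nat -> Z) : Prop :=
  (exists l : Z, x @ \oo --> l) \/ \bigcap_n xsection (U n) (x n) = set0.

Definition winning2 (sigma : seq (set (Z * Z)) -> Z) : Prop :=
  strategy2 sigma /\
  forall U, run1 U -> ~ wins1 U (fun n => sigma (mkseq U n.+1)).

End ProximalGame.

Definition semi_proximal_uniform (Z : uniformType) : Prop :=
  ~ exists sigma : seq (set (Z * Z)) -> Z, winning2 sigma.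

(** [Nbhs_isUniform_mixin] on a topological space [T] consists of a uniformity
    on [T] whose induced neighbourhood filters are those of [T]. *)
Definition semi_proximal (T : topologicalType) : Prop :=
  exists m : Nbhs_isUniform_mixin T, semi_proximal_uniform (HB.pack T m).

(* Main.v *)
Require Import Defs.
From HB Require Import structures.
From mathcomp Require Import all_boot all_order classical_sets topology.
From mathcomp Require Import boolp functions cardinality filter.
Set Implicit Arguments.
Unset Strict Implicit.
Unset Printing Implicit Defensive.
Import Order.TTheory.
Local Open Scope classical_set_scope.
Local Open Scope order_scope.

(** Fix a uniformity inducing the topology. The club-star property makes any
    two uncountable subsets of [omega_1 * {0}] accumulate at a common point
    [(alpha,1)], since two clubs meet. Hence every entourage [U] admits a bound
    [g] such that the points [(alpha,1)] with [alpha > g] are pairwise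
    [U]-close. Player II therefore wins by playing points [(alpha_n,1)] with
    [alpha_n] strictly increasing and above the bounds of all entourages played
    so far: any [(beta,1)] with [beta] large enough lies in every [U_n[x_n]],
    while the points [(alpha,1)] form a closed discrete set. *)

Section Omega1.
Context d (W : orderType d) (hW : is_omega1 W).

(** * Countable sets, suprema and clubs in [omega_1] *)

Lemma countable_le (a : W) : countable [set b | b <= a].
Proof.
have [_ _ cseg] := hW.
have: countable (\bigcup_(i in [set: bool]) if i then [set b | b < a] else [set a]).
  by apply: bigcup_countable => // -[] _; [exact: cseg|exact: countable1].
apply: sub_countable; apply: subset_card_le => b /=.
by rewrite le_eqVlt => /orP[/eqP->|ba]; [exists false|exists true].
Qed.

(** Otherwise the countable initial segments below the members of [A] would cover [W]. *)
Lemma countable_bounded (A : set W) :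
  countable A -> exists g, forall a, A a -> a < g.
Proof.
move=> cA; apply: contrapT => /forallNP nb.
have [_ ncW _] := hW; apply: ncW.
have: countable (\bigcup_(a in A) [set b | b <= a]).
  by apply: bigcup_countable => // a _; exact: countable_le.
apply: sub_countable; apply: subset_card_le => g _.
have /existsNP[a /not_implyP[Aa /negP]] := nb g.
by rewrite -leNgt => ga; exists a.
Qed.

Lemma seq_bounded (e : nat -> W) : exists g, forall n, e n < g.
Proof.
have [|g hg] := @countable_bounded (range e).
  exact: sub_countable (card_image_le _ _) (countableP _).
by exists g => n; apply: hg; exists n.
Qed.

Lemma exists_point : exists _ : W, True.
Proof. by have [g _] := @countable_bounded set0 (countable0 _); exists g. Qed.

Lemma exists_gt (a : W) : exists b, a < b.
Proof.
by have [g hg] := @countable_bounded [set a] (countable1 _); exists g; apply: hg.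
Qed.

Lemma well_founded_min (A : set W) :
  A !=set0 -> exists2 z, A z & forall y, A y -> z <= y.
Proof.
have [wf _ _] := hW; move=> [x]; elim: (wf x) => {}x _ IH Ax.
have [[y Ay yx]|nA] := pselect (exists2 y, A y & y < x); first exact: (IH y).
exists x => // y Ay; rewrite leNgt; apply/negP => yx.
by apply: nA; exists y.
Qed.

Lemma increasing_sup (e : nat -> W) : (forall n, e n < e n.+1) ->
  exists2 a, Lim W a & (forall n, e n < a) /\ forall b, b < a -> exists n, b < e n.
Proof.
move=> einc; have [a ea amin] := well_founded_min (seq_bounded e).
have eb b : b < a -> exists n, b < e n.
  move=> ba; apply: contrapT => /forallNP nb.
  suff: a <= b by rewrite leNgt ba.
  apply: amin => n; rewrite (lt_le_trans (einc n))// leNgt.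
  exact/negP/nb.
exists a => //; split; first by exists (e 0%N).
by move=> b /eb[n bn]; exists (e n).
Qed.

(** The closing-off argument: iterating a choice of [y] and taking the supremum produces limits
    closed under a given operation. *)
Lemma progressive_sup (P : W -> W -> Prop) :
  (forall x, exists2 y, x < y & P x y) ->
  exists e : nat -> W, (forall n, e n < e n.+1 /\ P (e n) (e n.+1)) /\
    exists2 a, Lim W a & (forall n, e n < a) /\ forall b, b < a -> exists n, b < e n.
Proof.
move=> hP; have [w _] := exists_point.
have /choice[f hf] : forall x, exists y, x < y /\ P x y.
  by move=> x; have [y xy Pxy] := hP x; exists y.
exists (fun n => iter n f w); split; first by move=> n; exact: hf.
by apply: increasing_sup => n; exact: (hf _).1.
Qed.

Lemma exists_Lim_gt (w : W) : exists a : Lim W, w < val a.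
Proof.
have [|e [he [a La [ea _]]]] := @progressive_sup (fun _ y => w < y).
  by move=> x; have [y] := exists_gt (Order.max x w); rewrite gt_max => /andP[]; exists y.
by exists (exist _ a (mem_set La)); apply: lt_trans (he 0%N).2 (ea 1%N).
Qed.

(** Each step of the sequence jumps over a point of [C] and a point of [D], so its supremum is a
    limit of both. *)
Lemma club_meet (C D : set W) : club C -> club D -> exists2 a, C a & D a.
Proof.
move=> [Cu Cc] [Du Dc].
have [|e [he [a La [ea ae]]]] := @progressive_sup
    (fun x y => (exists c, [/\ C c, x < c & c < y]) /\
                (exists c, [/\ D c, x < c & c < y])).
  move=> x; have [c Cc' xc] := Cu x; have [c' Dc' xc'] := Du x.
  have [y] := exists_gt (Order.max c c'); rewrite gt_max => /andP[cy cy'].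
  by exists y; [exact: lt_trans cy|split; [exists c|exists c']].
exists a.
  apply: Cc => // b /ae[n bn]; have [_ [[c [Cc' nc cn]] _]] := he n.
  by exists c; split=> //; [exact: lt_trans nc|exact: lt_trans (ea n.+1)].
apply: Dc => // b /ae[n bn]; have [_ [_ [c [Cc' nc cn]]]] := he n.
by exists c; split=> //; [exact: lt_trans nc|exact: lt_trans (ea n.+1)].
Qed.

(** Only finitely many terms of an increasing enumeration precede the first one known to be past
    [xi]. *)
Lemma order_type_omega_unbounded (A B : set W) (a xi : W) :
  cofinal_in A a -> order_type_omega A -> infinite_set (A `&` B) -> xi < a ->
  exists c, [/\ A c, B c & xi <= c].
Proof.
move=> [_ Acof] [e einc eA] inf xia; apply: contrapT => /forallNP nc; apply: inf.
have [c Ac xic] := Acof _ xia; move: (Ac); rewrite eA => -[m _ em].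
apply: (@sub_finite_set _ _ (e @` `I_m)); last exact/finite_image/finite_II.
move=> x [[k _ ek] Bx].
exists k => //=.
rewrite ltnNge; apply/negP => mk; apply: (nc x); split=> //.
  by rewrite eA; exists k.
apply: (le_trans xic); rewrite -em -ek.
by move: mk; rewrite leq_eqVlt => /orP[/eqP->//|/einc/ltW].
Qed.

(** * Relations that hold on a tail of every ladder *)

Section LadderRelation.
Variables (L : Lim W -> set W) (hL : ladder_system L) (S : W -> W -> Prop).
Hypothesis tailS : forall a : Lim W, exists2 xi, xi < val a &
  forall c c', L a c -> L a c' -> xi <= c -> xi <= c' -> S c c'.

(* Otherwise some limit [a] is closed under bounds of the sets [S x], so that
   no [S c] with [c < a] contains a tail of [L a]. *)
Lemma ladder_relation_uncountable : exists x, ~ countable [set y | S x y].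
Proof.
apply: contrapT => /forallNP cS.
have [|e [he [a La [ea ae]]]] := @progressive_sup
    (fun x y => forall b c, b <= x -> S b c -> c < y).
  move=> x; have [|g hg] := @countable_bounded
      (\bigcup_(b in [set b | b <= x]) [set c | S b c]).
    apply: bigcup_countable => [|b _]; first exact: countable_le.
    by apply: contrapT; exact: cS.
  have [y] := exists_gt (Order.max x g); rewrite gt_max => /andP[xy gy].
  by exists y => // b c bx Sbc; apply: lt_trans gy; apply: hg; exists b.
pose l : Lim W := exist _ a (mem_set La).
have [xi xia tl] := tailS l.
have [[Llt Lcof] _] := hL l.
have [c Lc xic] := Lcof _ xia.
have [n cn] := ae _ (Llt _ Lc).
have [|c' Lc'] := Lcof (Order.max xi (e n.+1)).
  by rewrite gt_max xia; exact: ea.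
rewrite ge_max => /andP[xic' nc'].
have := (he n).2 c c' (ltW cn) (tl _ _ Lc Lc' xic xic').
by rewrite ltNge nc'.
Qed.

Hypothesis hclub : club_star L.

(** A limit in both clubs has a ladder meeting [A] and [B] infinitely often, hence also inside the
    tail given by [tailS]. *)
Lemma ladder_relation_meet (A B : set W) : ~ countable A -> ~ countable B ->
  exists a b, [/\ A a, B b & S a b].
Proof.
move=> /hclub[C cC CA] /hclub[D cD DB].
have [_ /CA[l lA <-] /DB[l' lB /val_inj ll']] := club_meet cC cD.
move: lB; rewrite ll' /= => lB; have [xi xia tl] := tailS l.
have [Lc Lo] := hL l.
have [|a [La Aa xa]] := order_type_omega_unbounded (B := A) Lc Lo _ xia.
  by apply/infiniteP; rewrite (card_le_eqr lA).
have [|b [Lb Bb xb]] := order_type_omega_unbounded (B := B) Lc Lo _ xia.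
  by apply/infiniteP; rewrite (card_le_eqr lB).
by exists a, b; split=> //; apply: tl.
Qed.

(** If uncountably many points were out of reach of [x] in two steps, some step would still lead to
    one of them from the uncountable set of successors of [x]. *)
Lemma ladder_relation_cocountable :
  exists x g, forall y, g <= y -> exists2 z, S x z & S z y.
Proof.
have [x ncx] := ladder_relation_uncountable; exists x.
apply: contrapT => /forallNP nb.
have [|z [y [Sxz nSy Szy]]] :=
    @ladder_relation_meet _ [set y | ~ exists2 z, S x z & S z y] ncx.
  move=> /countable_bounded[g hg]; apply: (nb g) => y gy.
  by apply: contrapT => /hg; rewrite ltNge gy.
by apply: nSy; exists z.
Qed.

End LadderRelation.

(** * Uniformities and the proximal game *)

Lemma ladder_limits_close (L : Lim W -> set W) (Z : uniformType)
    (i : W -> Z) (j : Lim W -> Z) :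
  ladder_system L -> club_star L ->
  (forall V a, @entourage Z V -> exists2 xi, xi < val a &
     forall c, L a c -> xi <= c -> V (j a, i c)) ->
  forall U, @entourage Z U -> exists g, forall a b : Lim W,
    g < val a -> g < val b -> U (j a, j b).
Proof.
move=> hL hclub ij U entU.
have close_split (V : set (Z * Z)) : entourage V ->
    exists2 X, entourage X & (forall x y, X (x, y) -> X (y, x)) /\
      forall x y z, X (x, y) -> X (y, z) -> V (x, z).
  move=> entV; exists (split_ent V `&` (split_ent V)^-1%relation)%classic.
    by apply: filterI; [exact: entourage_split_ent|exact: entourage_inv].
  split=> [x y [? ?]|x y z [xy _] [yz _]]; first by split.
  exact: (entourage_split y).
(* Four halvings: tail points of a ladder are [U3]-close through [j a], two such steps from [i x]
   stay within [U2], the step to the limit point within [U1], and two limit points are joined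
   through [i x] within [U]. *)
have [U1 entU1 [U1C U1U]] := close_split _ entU.
have [U2 entU2 [U2C U2U]] := close_split _ entU1.
have [U3 entU3 [U3C U3U]] := close_split _ entU2.
have [U4 entU4 [U4C U4U]] := close_split _ entU3.
have [a|x [g hg]] := @ladder_relation_cocountable L hL
    (fun b c => U3 (i b, i c)) _ hclub.
  have [xi xia xiP] := ij U4 a entU4; exists xi => // c c' Lc Lc' xc xc'.
  by apply: (U4U _ (j a)); [apply/U4C|]; exact: xiP.
have near_x (a : Lim W) : g < val a -> U1 (i x, j a).
  move=> ga; have [xi xia xiP] := ij U2 a entU2.
  have [[_ Lcof] _] := hL a.
  have [|c Lc] := Lcof (Order.max xi g); first by rewrite gt_max xia.
  rewrite ge_max => /andP[xic /hg[z xz zc]].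
  apply: (U2U _ (i c)); first exact: U3U xz zc.
  by apply/U2C/xiP.
exists g => a b ga gb; apply: (U1U _ (i x)); last exact: near_x.
exact/U1C/near_x.
Qed.

Lemma limits_close_winning2 (Z : uniformType) (j : Lim W -> Z) :
  (forall U, @entourage Z U -> exists g, forall a b : Lim W,
    g < val a -> g < val b -> U (j a, j b)) ->
  (forall f : nat -> Lim W, (forall n, val (f n) < val (f n.+1)) ->
     ~ exists l : Z, j (f n) @[n --> \oo] --> l) ->
  exists sigma : seq (set (Z * Z)) -> Z, winning2 sigma.
Proof.
move=> jclose jdisc.
have [w _] := exists_point.
have /choice[g hg] : forall U, exists g, @entourage Z U -> forall a b : Lim W,
    g < val a -> g < val b -> U (j a, j b).
  move=> U; have [/jclose[g hg]|nU] := pselect (entourage U); first by exists g.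
  by exists w => /nU.
have /choice[next hnext] := exists_Lim_gt.
(* Player II remembers only the last limit; each entourage pushes it past itself and past the bound
   [g U]. *)
pose state := foldl (fun l U => next (Order.max (val l) (g U))) (next w).
have state_rcons s U : val (state s) < val (state (rcons s U)) /\
    g U < val (state (rcons s U)).
  rewrite /state foldl_rcons -/state.
  by have := hnext (Order.max (val (state s)) (g U)); rewrite gt_max => /andP.
exists (j \o state); split=> [s U V [entUV _]|U [entU _]].
  have {entUV}entU : entourage U.
    have := entUV (size s).
    by rewrite !size_rcons !nth_rcons size_rcons ltnSn ltnn eqxx; apply; rewrite ltnW.
  rewrite /xsection /=; apply/mem_set/(hg _ entU).
    by have [] := state_rcons s U.
  apply: lt_trans (state_rcons (rcons s U) V).1.
  by have [] := state_rcons s U.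
pose f n := state (mkseq U n.+1).
have finc n : val (f n) < val (f n.+1).
  by rewrite /f [mkseq U n.+2]mkseqS; exact: (state_rcons _ _).1.
have fg n : g (U n) < val (f n).
  by rewrite /f mkseqS; exact: (state_rcons _ _).2.
case; first exact: (jdisc f finc).
(* Any limit above all [f n] gives a point of the intersection. *)
have [b hb] := seq_bounded (fun n => val (f n)).
have [a ba] := exists_Lim_gt b.
move=> /seteqP[+ _] => /(_ (j a)); apply => n _.
rewrite /xsection /=; apply/mem_set/(hg (U n)) => //.
exact: lt_trans (fg n) (lt_trans (hb n) ba).
Qed.

(** A basic neighbourhood contains at most one point of the form [inr a], so a convergent sequence
    of such points is eventually constant. *)
Lemma increasing_limits_not_cvg (L : Lim W -> set W) (f : nat -> Lim W) :
  (forall n, val (f n) < val (f n.+1)) ->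
  ~ exists l : Psi L, (inr (f n) : Psi L) @[n --> \oo] --> l.
Proof.
move=> finc [[x|a]] cvg.
  have [|n _ /(_ n (leqnn n))] := cvg [set inl x]; last by [].
  exact/principal_filterP.
have [b ba] := (set_valP a).1.
have [|n _ hn] := cvg (@Psi_base _ _ L a b); first by exists b.
have fa m : (n <= m)%N -> f m = a by move=> /hn[[]|[? _]].
by have := finc n; rewrite !fa// ltxx.
Qed.

End Omega1.

Theorem theorem1 (d : Order.disp_t) (W : orderType d) (hW : is_omega1 W)
  (L : Lim W -> set W) (hL : ladder_system L) (hclub : club_star L) :
  ~ semi_proximal (Psi L).
Proof.
move=> [m]; apply.
pose Z : uniformType := HB.pack (Psi L) m.
apply: (@limits_close_winning2 d W hW Z (fun a : Lim W => inr a : Psi L)).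
  apply: (@ladder_limits_close d W hW L Z (fun c : W => inl c : Psi L)) => // V a entV.
  (* As [m] induces the topology of [Psi L], the [V]-ball at [inr a] contains a basic neighbourhood,
     hence a tail of the ladder. *)
  have [xi xia sub] := @nbhs_entourage Z (inr a : Psi L) V entV.
  exists xi => // c Lc xic; apply/set_mem/sub; right; exists c => //; split=> //=.
  by apply/negP; rewrite -leNgt.
exact: increasing_limits_not_cvg.
Qed.
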